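(* Let $m\ge -1$. Any palindrome that occurs in $\mathbb{F}$ and has kernel $K_m$ can be expressed uniquely as $$K_{m+1}[i+1,f_{m+1}]\,K_m\,K_{m+1}[1,f_{m+1}-i]=K_{m+3}[i+1,f_{m+3}-i],$$ where $1\le i\le f_{m+1}$.
   Context: The Fibonacci sequence $\mathbb{F}$ is the infinite word over $\{a,b\}$ that begins with $a$ and is fixed by the morphism $\sigma$ with $\sigma(a)=ab$, $\sigma(b)=a$. Put $F_{-1}=b$ and $F_m=\sigma^m(a)$ for $m\ge 0$; the length of $F_m$ is $f_m$, where $f_{-1}=f_0=1$ and $f_{m+1}=f_m+f_{m-1}$ for $m\ge 0$. Let $\delta_m$ be the last letter of $F_m$ ($\delta_m=a$ if $m$ is even, $\delta_m=b$ if $m$ is odd). The $m$-th singular word ($m\ge -1$) is $K_m=\delta_{m+1}F_m\delta_m^{-1}$, i.e. the word obtained from $F_m$ by deleting its last letter $\delta_m$ and prepending $\delta_{m+1}$; thus $K_{-1}=a$, $K_0=b$, $K_1=aa$, $K_2=bab$, and $|K_m|=f_m$. For a nonempty factor $\omega$ of $\mathbb{F}$, its kernel $Ker(\omega)$ is the maximal singular word occurring in $\omega$, i.e. $K_m$ with the largest index $m$ such that $K_m$ is a factor of $\omega$. For a finite word $\tau$, $\tau[i,j]$ is the factor from the $i$-th to the $j$-th letter (indexed from $1$), with $\tau[i,i-1]$ equal to the empty word. A palindrome is a word equal to its reversal. *)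

(* Defs.v *)
From mathcomp Require Import all_boot all_order all_algebra.

Set Implicit Arguments.
Unset Strict Implicit.
Unset Printing Implicit Defensive.

Import Order.TTheory GRing.Theory Num.Theory.

Local Open Scope ring_scope.

(* The alphabet {a, b} is encoded by the booleans. *)
Definition letter := bool.
Definition a : letter := false.
Definition b : letter := true.

Definition word := seq letter.
Definition infinite_word := nat -> letter.

Definition sigma_letter (x : letter) : word :=
  if x == a then [:: a; b] else [:: a].

Definition sigma (w : word) : word := flatten [seq sigma_letter x | x <- w].

(* sigma u = u for infinite u: the image of every prefix of u is a prefix of u
   (these images have unbounded length since sigma is non-erasing). *)
Definition fixed_by_sigma (u : infinite_word) : Prop :=
  forall n : nat, sigma (mkseq u n) = mkseq u (size (sigma (mkseq u n))).

Definition fibonacci_sequence (u : infinite_word) : Prop :=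
  u 0%N = a /\ fixed_by_sigma u.

(* F_m, f_m, delta_m and K_m are only meaningful for m >= -1; the values at
   m < -1 are junk. *)
Definition Fw (m : int) : word :=
  match m with
  | Posz n => iter n sigma [:: a]
  | Negz _ => [:: b]
  end.

Definition f (m : int) : nat := size (Fw m).

Definition delta (m : int) : letter := last a (Fw m).

Definition K (m : int) : word :=
  delta (m + 1) :: take (size (Fw m)).-1 (Fw m).

(* w[i, j], letters numbered from 1; empty when j = i - 1. *)
Definition factor (w : word) (i j : nat) : word :=
  take (j.+1 - i) (drop i.-1 w).

Definition palindrome (w : word) : Prop := rev w = w.

Definition occurs_in (w : word) (u : infinite_word) : Prop :=
  exists k : nat, w = mkseq (fun j => u (k + j)%N) (size w).

(* v = Ker(w). This forces w to be nonempty, as every K j is nonempty. *)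
Definition is_kernel (w v : word) : Prop :=
  exists j : int,
    [/\ -1 <= j, v = K j, infix (K j) w
      & forall l : int, -1 <= l -> infix (K l) w -> l <= j].

Lemma sigma_cat (u v : word) : sigma (u ++ v) = sigma u ++ sigma v.
Proof. by rewrite /sigma map_cat flatten_cat. Qed.

Lemma iter_sigma (k : nat) :
  iter k.+2 sigma [:: a] = iter k.+1 sigma [:: a] ++ iter k sigma [:: a].
Proof.
by elim: k => [|k IH] //; rewrite [LHS]iterS [in LHS]IH sigma_cat.
Qed.

Lemma Fw_rec (n : nat) : Fw (n%:Z + 1) = Fw n%:Z ++ Fw (n%:Z - 1).
Proof.
case: n => [|n] //.
have -> : n.+1%:Z + 1 = n.+2%:Z by rewrite -PoszD addn1.
have -> : n.+1%:Z - 1 = n%:Z by rewrite -addn1 PoszD addrK.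
exact: iter_sigma.
Qed.

Lemma f_rec (n : nat) : f (n%:Z + 1) = (f n%:Z + f (n%:Z - 1))%N.
Proof. by rewrite /f Fw_rec size_cat. Qed.

Lemma fibonacci_sequence_exists : exists u, fibonacci_sequence u.
Proof.
pose X k := iter k sigma [:: a].
have sz k : (k < size (X k))%N.
  suff [h1 h2] : (k < size (X k))%N /\ (k.+1 < size (X k.+1))%N by [].
  elim: k => [|k [h1 h2]] //; split=> //.
  have E : X k.+2 = X k.+1 ++ X k by exact: iter_sigma.
  rewrite E size_cat -addn1 leq_add //; exact: leq_trans h1.
have pre k : prefix (X k) (X k.+1).
  elim: k => [|k /prefixP [s Es]] //.
  apply/prefixP; exists (sigma s).
  exact: etrans (congr1 sigma Es) (sigma_cat _ _).
have preD k l : prefix (X k) (X (k + l)%N).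
  elim: l => [|l IH]; first by rewrite addn0 prefix_refl.
  rewrite addnS; exact: prefix_trans IH (pre _).
pose u n := nth a (X n) n.
have uE k n : (n < size (X k))%N -> u n = nth a (X k) n.
  move=> h; rewrite /u; case: (leqP k n) => hk.
    have /prefixP [s Es] := preD k (n - k)%N.
    by move: Es; rewrite subnKC // => ->; rewrite nth_cat h.
  have /prefixP [s Es] := preD n (k - n)%N.
  by move: Es; rewrite subnKC ?(ltnW hk) // => ->; rewrite nth_cat sz.
have uP k n : (n <= size (X k))%N -> mkseq u n = take n (X k).
  move=> h; apply: (@eq_from_nth _ a); first by rewrite size_mkseq size_takel.
  move=> i; rewrite size_mkseq => hi.
  by rewrite nth_mkseq // nth_take // (uE k) // (leq_trans hi).
exists u; split=> // n.
have hn := ltnW (sz n).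
have E : X n.+1 = sigma (mkseq u n) ++ sigma (drop n (X n)).
  by rewrite (uP n) // -sigma_cat cat_take_drop.
rewrite [RHS](uP n.+1) E ?take_size_cat //.
by rewrite size_cat leq_addr.
Qed.

(* Main.v *)
Require Import Defs.
From mathcomp Require Import all_boot all_order all_algebra.
From mathcomp Require Import zify.

(** Everything rests on where the singular word K_m occurs in F.  Since F is
    the image of itself under sigma, F is for every m >= 0 a concatenation of
    blocks F_m and F_(m-1), the images under sigma^m of the letters a and b.
    Desubstituting one step at a time shows that an occurrence of K_m can
    only begin at the last letter of a block F_(m-1), that is, of the image
    of some b (singular_position).  Two consequences follow by reading the
    next letters of F, which contains neither bb nor aaa.

    - An occurrence of K_m is followed by K_(m+1) deprived of its last letter;
      one letter further, either K_(m+1) is completed there, or K_(m+2) is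
      completed from the start of K_m (singular_follow).
    - Two occurrences of K_m are at least f_(m+1) letters apart
      (singular_separation).

    Let w be a palindrome of kernel K_m, and write w = x K_m y.  As w contains
    neither K_(m+1) nor K_(m+2), the first fact makes y a prefix of K_(m+1)
    shorter than f_(m+1).  As w and K_m are palindromes, w is also
    rev y K_m rev x, so that x too is short, and two different lengths
    for x and y would give two occurrences of K_m that are too close.  Hence
    x = rev y, and w is determined by the length of y, which is what the index
    i records (palindrome_with_kernel).

    The displayed identity between the two expressions of the palindrome is
    K_(m+3) = K_(m+1) K_m K_(m+1) (singular_SSS) with i letters cut on either
    side.

    Indices are shifted by one, so that they are natural numbers: fib_word n
    is F_(n-1) and singular n is K_(n-1). *)

Import Order.TTheory GRing.Theory Num.Theory.

Local Open Scope nat_scope.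

(** * Fibonacci words and singular words *)

(** As sigma b = a, iterating from b instead of a realizes the index shift
    and includes F_(-1) without a separate case. *)
Definition fib_word (n : nat) : word := iter n sigma [:: b].

Definition stem (n : nat) : word :=
  take (size (fib_word n)).-1 (fib_word n).

(** The letter prepended to F_(n-1) is delta_n, which is b exactly when n is
    odd. *)
Definition singular (n : nat) : word := odd n :: stem n.

Lemma fib_wordSS n : fib_word n.+2 = fib_word n.+1 ++ fib_word n.
Proof.
elim: n => [|n IH] //.
exact: etrans (congr1 sigma IH) (sigma_cat _ _).
Qed.

Lemma iter_sigma_cat n u v :
  iter n sigma (u ++ v) = iter n sigma u ++ iter n sigma v.
Proof. by elim: n => [|n IH] //=; rewrite IH sigma_cat. Qed.

Lemma fib_word_iter_a n : iter n sigma [:: a] = fib_word n.+1.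
Proof. by rewrite /fib_word iterSr. Qed.

Lemma size_fib_word_gt0 n : 0 < size (fib_word n).
Proof.
elim: n => [|[|n] IH] //.
by rewrite fib_wordSS size_cat addn_gt0 IH.
Qed.

Lemma leq_size_fib_word n : size (fib_word n) <= size (fib_word n.+1).
Proof. by case: n => [|n] //; rewrite fib_wordSS size_cat leq_addr. Qed.

(** Fibonacci words almost commute: exchanging two consecutive ones only
    swaps the last two letters.  This also gives the last two letters of
    fib_word n.+2. *)
Lemma fib_word_near_comm n :
  {c : word | fib_word n.+1 ++ fib_word n = c ++ [:: odd n; ~~ odd n]
            & fib_word n ++ fib_word n.+1 = c ++ [:: ~~ odd n; odd n]}.
Proof.
elim: n => [|n [c E1 E2]]; first by exists [::].
exists (fib_word n.+1 ++ c).
- by rewrite fib_wordSS -catA E2 catA /= negbK.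
- by rewrite fib_wordSS E1 catA /= negbK.
Qed.

Lemma fib_word_stem n : fib_word n = rcons (stem n) (~~ odd n).
Proof.
case: n => [|[|n]] //.
have [c E _] := fib_word_near_comm n.
rewrite /stem fib_wordSS E -cat_rcons cats1 size_rcons /= negbK.
by rewrite -(cats1 (rcons c _)) take_size_cat ?size_rcons ?cats1.
Qed.

(** The shape in which the definition of singular words is used: the letter
    ~~ odd n ends fib_word n and starts singular n.+1, so in a product of
    fib_words each boundary letter can be handed over to the next factor. *)
Lemma rcons_singular n : rcons (singular n) (~~ odd n) = odd n :: fib_word n.
Proof. by rewrite [in RHS]fib_word_stem. Qed.

Lemma size_singular n : size (singular n) = size (fib_word n).
Proof. by rewrite [in RHS]fib_word_stem size_rcons. Qed.

(** F_(n+2) = F_n F_(n-1) F_n, with the boundary letters handed over. *)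
Lemma singular_SSS n :
  singular n.+3 = singular n.+1 ++ singular n ++ singular n.+1.
Proof.
have shift1 : rcons (singular n) (odd n.+1) = odd n :: fib_word n.
  exact: rcons_singular.
have shift2 : rcons (singular n.+1) (odd n) = odd n.+1 :: fib_word n.+1.
  by rewrite -rcons_singular /= negbK.
apply: (@rcons_injl _ (~~ odd n.+3)); rewrite rcons_singular !rcons_cat.
have -> : odd n.+3 = odd n.+1 by rewrite /= negbK.
rewrite rcons_singular -(cat_rcons (odd n.+1)) shift1 cat_cons.
by rewrite -(cat_rcons (odd n)) shift2 fib_wordSS (fib_wordSS n) cat_cons catA.
Qed.

Lemma rev_singular n : rev (singular n) = singular n.
Proof.
elim/ltn_ind: n => -[|[|[|n]]] // IH.
by rewrite singular_SSS !rev_cat !IH ?catA //; lia.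
Qed.

(** Lengths separate all singular words except singular 0 and singular 1,
    which both have length 1; these differ by their first letter.  Comparing
    parities first, by the first letter, leaves indices at least two apart,
    where the lengths are strictly ordered. *)
Lemma singular_inj : injective singular.
Proof.
have lt k l : k.+2 <= l -> size (singular k) < size (singular l).
  elim: l => [|l IH] //; rewrite leq_eqVlt => /orP[/eqP [<-]|/IH h].
    rewrite !size_singular fib_wordSS size_cat.
    by have := leq_size_fib_word k; have := size_fib_word_gt0 k; lia.
  by apply: leq_trans h _; rewrite !size_singular leq_size_fib_word.
move=> k l E; have /(congr1 (head a)) /= par := E.
case: (ltngtP k l) => // h.
- suff /lt : k.+2 <= l by rewrite E ltnn.
  by lia.
- suff /lt : l.+2 <= k by rewrite E ltnn.
  by lia.
Qed.

(** * Occurrences in an infinite word *)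

Section Occurrences.
Variable F : infinite_word.

Definition occurs_at (p : nat) (w : word) : Prop :=
  map F (iota p (size w)) = w.

Lemma occurs_inP w : occurs_in w F <-> exists p, occurs_at p w.
Proof.
suff E p : map F (iota p (size w)) = mkseq (fun j => F (p + j)) (size w).
  by split=> -[p]; exists p; rewrite ?/occurs_at ?E // -E.
by rewrite -[in iota p](addn0 p) iotaDl -map_comp.
Qed.

Lemma occurs_at_cat p u v :
  occurs_at p (u ++ v) <-> occurs_at p u /\ occurs_at (p + size u) v.
Proof.
rewrite /occurs_at size_cat iotaD map_cat; split=> [/eqP|[-> ->] //].
by rewrite eqseq_cat ?size_map ?size_iota // => /andP[/eqP-> /eqP->].
Qed.

Lemma occurs_at_cons p x w :
  occurs_at p (x :: w) <-> F p = x /\ occurs_at p.+1 w.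
Proof. by rewrite /occurs_at /=; split=> [[-> ->]|[-> ->]]. Qed.

Lemma occurs_at_prefix p u v :
  occurs_at p u -> occurs_at p v -> size u <= size v -> prefix u v.
Proof.
move=> hu hv le_uv; apply/prefixP; exists (drop (size u) v).
rewrite -{1}hu -[v in LHS]hv -{2}hv -map_drop -map_cat drop_iota.
by rewrite -iotaD subnKC.
Qed.

(** * Cutting the Fibonacci sequence into images of letters *)

Hypothesis hF : fibonacci_sequence F.

(** Position in F at which the image of the n-th letter of F begins.  Its
    m-th iterate is the position of the corresponding block of sigma^m. *)
Definition image_length (n : nat) : nat := size (sigma (map F (iota 0 n))).

Lemma occurs_at_sigma n u : occurs_at n u ->
  occurs_at (image_length n) (sigma u) /\
  image_length (n + size u) = image_length n + size (sigma u).
Proof.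
move=> hu; have fix_prefix k :
    sigma (map F (iota 0 k)) = map F (iota 0 (image_length k)).
  by case: hF => _ /(_ k).
have hsize : image_length (n + size u) = image_length n + size (sigma u).
  by rewrite /image_length iotaD map_cat add0n hu sigma_cat size_cat.
split=> //; have := fix_prefix (n + size u).
rewrite iotaD map_cat add0n hu sigma_cat hsize iotaD map_cat fix_prefix.
by rewrite /occurs_at add0n => /eqP; rewrite eqseq_cat // => /andP[_ /eqP].
Qed.

Lemma image_lengthS n : image_length n.+1 = image_length n + (~~ F n).+1.
Proof.
have [|_] := @occurs_at_sigma n [:: F n]; first by [].
by rewrite addn1 => ->; case: (F n).
Qed.

(** The block of a letter is a followed by b when the letter is a; when it is
    b, the block is a alone and the next letter is the a starting the next
    block.  So the second letter always tells which block it is. *)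
Lemma F_image_length n :
  F (image_length n) = a /\ F (image_length n).+1 = ~~ F n.
Proof.
have [] := @occurs_at_sigma n [:: F n; F n.+1]; first by [].
by case: (F n) => + _; case: (F n.+1) => -[] //.
Qed.

Lemma image_length_cover p :
  exists n, p = image_length n \/ p = (image_length n).+1 /\ F n = a.
Proof.
elim: p => [|p [n [->|[-> Fn]]]]; first by exists 0; left.
- case Fn: (F n); last by exists n; right.
  by exists n.+1; left; rewrite image_lengthS Fn addn1.
- by exists n.+1; left; rewrite image_lengthS Fn /= addn2.
Qed.

Lemma F_a p : F p = a -> exists n, p = image_length n.
Proof.
have [n [->|[-> Fn]]] := image_length_cover p; first by exists n.
by rewrite (proj2 (F_image_length n)) Fn.
Qed.

Lemma no_bb p : F p = b -> F p.+1 = a.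
Proof.
have [n [->|[-> Fn _]]] := image_length_cover p.
  by have [->] := F_image_length n.
have := proj1 (F_image_length n.+1).
by rewrite image_lengthS Fn /= addn2.
Qed.

Lemma no_aaa p : F p = a -> F p.+1 = a -> F p.+2 = b.
Proof.
move=> /F_a [n ->]; have [_ -> /negbFE Fn] := F_image_length n.
have := proj2 (F_image_length n.+1).
by rewrite image_lengthS Fn addn1 (no_bb n Fn).
Qed.

Lemma ltn_image_length : {homo image_length : m n / m < n}.
Proof.
by apply: homo_ltn => [? ? ?|n]; [exact: ltn_trans|rewrite image_lengthS; lia].
Qed.

(** The a after sigma u marks the end of its last block; without it an image
    ending with a could be completed to ab. *)
Lemma desubstitute p u : occurs_at p (sigma u ++ [:: a]) ->
  exists2 n, p = image_length n & occurs_at n u.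
Proof.
have aux n v : occurs_at (image_length n) (sigma v ++ [:: a]) -> occurs_at n v.
  elim: v n => [|x v IH] n //.
  have hd q : occurs_at q (sigma v ++ [:: a]) -> F q = a.
    by case: (v) => [|[] ?] /occurs_at_cons [].
  rewrite -cat1s sigma_cat -catA => /occurs_at_cat [hx hv].
  have Fn : F n = x.
    have [_] := F_image_length n.
    case: x hx hv => [_ /hd|/occurs_at_cons [_ /occurs_at_cons [-> _]] _].
      by rewrite addn1 => -> /esym /negbFE.
    by move=> /esym /negbTE.
  apply/occurs_at_cons; split=> //; apply: IH.
  by rewrite image_lengthS Fn; case: (x) hv.
move=> h; have /F_a [n En] : F p = a.
  by case: u h => [|[] ?] /occurs_at_cons [].
by exists n => //; apply: aux; rewrite -En.
Qed.

(** * Positions of singular words *)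

(** Without its first letter, singular n.+2 is sigma (fib_word n.+1) deprived
    of its last letter.  It starts a block, and it decodes to fib_word n.+1
    deprived of its last letter; the letter before it is the last letter of a
    block, which is the complement of the letter that the block codes. *)
Lemma desubstitute_singular n p : occurs_at p (singular n.+2) ->
  exists2 q, occurs_at q (singular n.+1) & p.+1 = image_length q.+1.
Proof.
have EW : fib_word n.+2 = sigma (rcons (stem n.+1) (odd n)).
  by rewrite -[odd n]negbK -(fib_word_stem n.+1).
move=> /occurs_at_cons [Fp hp].
have [q Eq hq] : exists2 q, p.+1 = image_length q & occurs_at q (stem n.+1).
  have {}EW : rcons (stem n.+2) (~~ odd n) = sigma (stem n.+1) ++ sigma [:: odd n].
    by rewrite -sigma_cat cats1 -EW fib_word_stem /= negbK.
  case on: (odd n) EW => /= EW.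
    (* fib_word n.+1 ends with ab here.  The image of its stem is complete but
       not followed by a known a, so the last a of the stem is decoded apart,
       from the b that ends its image. *)
    move: EW; rewrite /= cats1 => /rcons_inj [Es].
    have [c Ec] : exists c, stem n.+1 = rcons c a.
      case: (n) on => [|j] //= /negbTE oj.
      have [c E _] := fib_word_near_comm j; exists c.
      apply: (@rcons_injl _ (~~ odd j)); rewrite -fib_wordSS fib_word_stem /= negbK in E.
      by rewrite E oj -cats1 -cats1 -catA.
    rewrite Es Ec -cats1 sigma_cat in hp.
    have [] := @desubstitute p.+1 c.
      by move: hp; rewrite -[sigma [:: a]]/([:: a] ++ [:: b]) catA => /occurs_at_cat [].
    move=> q Eq hc; exists q => //; rewrite Ec -cats1.
    apply/occurs_at_cat; split=> //; have [_ Esz] := occurs_at_sigma _ _ hc.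
    move: hp => /occurs_at_cat [_]; rewrite Eq -Esz.
    move=> /occurs_at_cons [_ /occurs_at_cons [+ _]].
    have [_ ->] := F_image_length (q + size c).
    by move=> /negbTE Fq; apply/occurs_at_cons.
  (* fib_word n.+1 ends with a, whose image ab loses its b here; the a that
     remains marks the end of the image of the stem. *)
  have Es : stem n.+2 = sigma (stem n.+1) ++ [:: a].
    by apply: (@rcons_injl _ (~~ false)); rewrite EW -cats1 -catA.
  by apply: desubstitute; rewrite -Es.
case: q Eq hq => [|q] Eq hq //; exists q => //.
apply/occurs_at_cons; split=> //=; rewrite /= negbK in Fp; rewrite -Fp.
move: Eq; rewrite image_lengthS; have [Fa Fb] := F_image_length q.
case Fq: (F q) Fb => Fb /=; rewrite ?addn1 ?addn2 => -[->].
  by rewrite Fa.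
by rewrite Fb.
Qed.

Lemma occurs_at_iter_sigma n k u : occurs_at k u ->
  occurs_at (iter n image_length k) (iter n sigma u) /\
  iter n image_length (k + size u)
    = iter n image_length k + size (iter n sigma u).
Proof.
move=> hu; elim: n => [|n [IH1 IH2]] //=; rewrite IH2.
exact: occurs_at_sigma.
Qed.

(** The letter at p ends the n-th image of the prefix of F that ends with the
    b at k.  By induction through desubstitution, down to the word b. *)
Lemma singular_position n p : occurs_at p (singular n.+1) ->
  exists2 k, F k = b & p.+1 = iter n image_length k.+1.
Proof.
elim: n p => [|n IH] p; first by move=> /occurs_at_cons [Fp _]; exists p.
move=> /desubstitute_singular [q /IH [k Fk Eq] Ep].
by exists k => //; rewrite iterS -Eq.
Qed.

(** Consider K_n, that is, singular n.+1.  After the b at position k that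
    locates it, F reads aab or aba.  Under the n-th image, aab gives
    F_n F_n F_(n-1) = F_n F_(n+1), where singular n.+2 follows singular n.+1;
    aba gives F_n F_(n-1) F_n = F_(n+2), which completes
    singular n.+3.  In the second case F_(n-1) F_n still agrees with
    F_(n+1) = F_n F_(n-1) up to the last two letters. *)
Lemma singular_follow n p : occurs_at p (singular n) ->
  (exists2 s, prefix s (singular n.+1) &
     size s = (size (fib_word n.+1)).-1 /\
     occurs_at (p + size (singular n)) s) /\
  (occurs_at (p + size (singular n)) (singular n.+1)
   \/ occurs_at p (singular n.+2)).
Proof.
case: n => [|n] hp.
  split; first by exists [::].
  move: hp => /occurs_at_cons [Fp _]; rewrite addn1.
  case Fp1: (F p.+1); first by left; apply/occurs_at_cons.
  by right; do 2 (apply/occurs_at_cons; split=> //).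
have [k Fk Ep] := singular_position _ _ hp.
have Fk1 := no_bb _ Fk.
have start u : occurs_at k.+1 u -> occurs_at p (odd n.+1 :: iter n sigma u).
  move=> /(occurs_at_iter_sigma n) [hu _]; rewrite -Ep in hu.
  by apply/occurs_at_cons; split=> //; case/occurs_at_cons: hp.
case Fk2: (F k.+2).
- have : occurs_at k.+1 ([:: a] ++ [:: b] ++ [:: a]).
    by do 3 (apply/occurs_at_cons; split=> //); exact: no_bb.
  move/start; rewrite !iter_sigma_cat fib_word_iter_a -/(fib_word n) => h; split.
    have [c E1 E2] := fib_word_near_comm n.
    exists (odd n :: c).
      suff -> : singular n.+2 = rcons (odd n :: c) (odd n) by exact: prefix_rcons.
      apply: (@rcons_injl _ (~~ odd n.+2)); rewrite rcons_singular fib_wordSS E1.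
      by rewrite /= negbK -!cats1 -catA.
    split; first by rewrite fib_wordSS E1 size_cat addn2.
    move: h; rewrite -cat_cons -rcons_singular E2 cat_rcons.
    move=> /occurs_at_cat [_]; rewrite -cat_cons => /occurs_at_cat [].
    by rewrite /= negbK.
  right; move: h; rewrite catA -fib_wordSS -fib_wordSS.
  rewrite -[odd n.+1]negbK -[~~ ~~ _]/(odd n.+3).
  by rewrite -rcons_singular -cats1 => /occurs_at_cat [].
- have : occurs_at k.+1 ([:: a] ++ [:: a] ++ [:: b]).
    by do 3 (apply/occurs_at_cons; split=> //); exact: no_aaa.
  move/start; rewrite !iter_sigma_cat fib_word_iter_a -/(fib_word n) -fib_wordSS.
  rewrite -cat_cons -rcons_singular cat_rcons -[~~ odd n.+1]/(odd n.+2).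
  rewrite -rcons_singular -cats1 => /occurs_at_cat [_ /occurs_at_cat [h _]].
  split; last by left.
  exists (take (size (fib_word n.+2)).-1 (singular n.+2)); first exact: prefix_take.
  split; first by rewrite size_takel // size_singular leq_pred.
  move: h; rewrite -{1}(cat_take_drop (size (fib_word n.+2)).-1 (singular n.+2)).
  by case/occurs_at_cat.
Qed.

(** Two occurrences of K_n = singular n.+1 come from two letters b of F.
    These are not adjacent, so the positions differ by at least the lengths of
    the n-th images of the a that follows the first b and of one more letter,
    which are f_n and at least f_(n-1). *)
Lemma singular_separation n p q :
  occurs_at p (singular n) -> occurs_at q (singular n) -> p < q ->
  size (fib_word n.+1) <= q - p.
Proof.
case: n => [|n]; first by rewrite subn_gt0.
move=> /singular_position [k Fk Ep] /singular_position [l Fl Eq] lt_pq.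
have mono : {mono iter n image_length : i j / i < j}.
  apply: leqW_mono; apply: leq_mono.
  by elim: n {Ep Eq} => [|n IH] i j //= /IH /ltn_image_length.
have lt_kl : k < l by rewrite -ltnS -(mono) -Ep -Eq ltnS.
have Fk1 := no_bb _ Fk.
have lt_kl1 : k.+1 < l.
  by rewrite ltn_neqAle lt_kl andbT; apply/eqP=> E; rewrite -E Fk1 in Fl.
have [|_] := @occurs_at_iter_sigma n k.+1 ([:: a] ++ [:: F k.+2]).
  by do 2 (apply/occurs_at_cons; split=> //).
rewrite iter_sigma_cat fib_word_iter_a size_cat addn2 -Ep.
have : size (fib_word n) <= size (iter n sigma [:: F k.+2]).
  case: (F k.+2); rewrite ?fib_word_iter_a //; exact: leq_size_fib_word.
have : iter n image_length k.+3 <= iter n image_length l.+1.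
  by rewrite leqNgt mono -leqNgt.
rewrite -Eq fib_wordSS => le_q le_size E3.
rewrite E3 addSn ltnS in le_q; rewrite leq_subRL ?(ltnW lt_pq) //.
apply: leq_trans _ le_q; rewrite leq_add2l.
by rewrite !size_cat leq_add2l.
Qed.

(** * Palindromes with a given kernel *)

(** A longer y would complete singular n.+1 or singular n.+2 inside the word. *)
Lemma kernel_right_factor n s x y :
  occurs_at s (x ++ singular n ++ y) ->
  (forall l, n < l -> ~~ infix (singular l) (x ++ singular n ++ y)) ->
  size y < size (fib_word n.+1) /\ prefix y (singular n.+1).
Proof.
move=> hw kerw; have /occurs_at_cat [_ hKy] := hw.
have /occurs_at_cat [hK hy] := hKy.
have [[t pre [szt ht]] alt] := singular_follow _ _ hK.
have lty : size y < size (fib_word n.+1).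
  rewrite ltnNge; apply/negP=> le_y; case: alt => h.
    have /prefixP [z Ez] : prefix (singular n.+1) y.
      by apply: occurs_at_prefix h hy _; rewrite size_singular.
    by have /negP[] := kerw n.+1 (ltnSn n); rewrite Ez catA infix_infix.
  have /prefixP [z Ez] : prefix (singular n.+2) (singular n ++ y).
    apply: occurs_at_prefix h hKy _.
    by rewrite size_cat !size_singular fib_wordSS size_cat; lia.
  by have /negP[] := kerw n.+2 (ltnW (ltnSn n.+1)); rewrite Ez infix_infix.
split=> //; apply: prefix_trans pre; apply: occurs_at_prefix hy ht _.
by rewrite szt; move: lty (size_fib_word_gt0 n.+1); lia.
Qed.

(** Reversal exchanges the roles of x and y in w = x (singular n) y, so both
    are shorter than fib_word n.+1, and the occurrences of singular n in w
    after size x and after size y letters must coincide. *)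
Lemma palindrome_with_kernel n w :
  palindrome w -> occurs_in w F -> infix (singular n) w ->
  (forall l, n < l -> ~~ infix (singular l) w) ->
  exists y, [/\ w = rev y ++ singular n ++ y,
    size y < size (fib_word n.+1) & prefix y (singular n.+1)].
Proof.
move=> pal /occurs_inP [s hs] /infixP [x [y Ew]] kerw.
have Ew' : w = rev y ++ singular n ++ rev x.
  by rewrite -pal Ew !rev_cat rev_singular catA.
have [lty prey] : size y < size (fib_word n.+1) /\ prefix y (singular n.+1).
  by apply: (@kernel_right_factor n s x); rewrite -Ew.
have [ltx _] : size (rev x) < size (fib_word n.+1) /\ prefix (rev x) (singular n.+1).
  by apply: (@kernel_right_factor n s (rev y)); rewrite -Ew'.
have hx : occurs_at (s + size x) (singular n).
  by move: hs; rewrite Ew => /occurs_at_cat [_ /occurs_at_cat []].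
have hy : occurs_at (s + size y) (singular n).
  by move: hs; rewrite Ew' => /occurs_at_cat [_ /occurs_at_cat []]; rewrite size_rev.
rewrite size_rev in ltx.
have Exy : size x = size y.
  case: (ltngtP (size x) (size y)) => // h.
    have := singular_separation _ _ _ hx hy; lia.
  have := singular_separation _ _ _ hy hx; lia.
exists y; split=> //; rewrite Ew; congr (_ ++ _).
have /eqP := etrans (esym Ew) Ew'.
by rewrite eqseq_cat ?size_rev // => /andP[/eqP].
Qed.

End Occurrences.

Local Open Scope ring_scope.

(** * The statement with integer indices *)

Lemma Fw_fib_word n : Fw (n%:Z - 1) = fib_word n.
Proof.
case: n => [|n] //.
have -> : n.+1%:Z - 1 = n%:Z by lia.
exact: fib_word_iter_a.
Qed.

Lemma K_singular n : K (n%:Z - 1) = singular n.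
Proof.
rewrite /K /delta Fw_fib_word.
have -> : n%:Z - 1 + 1 = n.+1%:Z - 1 by lia.
by rewrite Fw_fib_word (fib_word_stem n.+1) last_rcons /= negbK.
Qed.

Theorem mainTheorem3 (F : infinite_word) (hF : fibonacci_sequence F)
    (m : int) (hm : -1 <= m) :
  (forall i : nat, (1 <= i <= f (m + 1))%N ->
     factor (K (m + 1)) i.+1 (f (m + 1)) ++ K m
       ++ factor (K (m + 1)) 1 (f (m + 1) - i)
     = factor (K (m + 3)) i.+1 (f (m + 3) - i)) /\
  (forall w : word,
     palindrome w -> occurs_in w F -> is_kernel w (K m) ->
     exists! i : nat,
       (1 <= i <= f (m + 1))%N /\
       w = factor (K (m + 1)) i.+1 (f (m + 1)) ++ K m
             ++ factor (K (m + 1)) 1 (f (m + 1) - i)).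
Proof.
have index (j : int) : -1 <= j -> exists k : nat, j = k%:Z - 1.
  by move=> hj; exists (absz (j + 1)); lia.
have [n ->] := index m hm.
have -> : n%:Z - 1 + 1 = n.+1%:Z - 1 by lia.
have -> : n%:Z - 1 + 3 = n.+3%:Z - 1 by lia.
rewrite /f !Fw_fib_word !K_singular.
set N := size (fib_word n.+1).
have szK : size (singular n.+1) = N := size_singular n.+1.
have leftE i : factor (singular n.+1) i.+1 N = drop i (singular n.+1).
  by rewrite /factor subSS /= take_oversize // size_drop szK.
have rightE i : factor (singular n.+1) 1 (N - i) = take (N - i) (singular n.+1).
  by rewrite /factor subn1 drop0.
split=> [i /andP[_ le_iN]|w pal occ [j [hj Ej infK max]]].
  rewrite leftE rightE /factor subSS -[i.+1.-1]/i singular_SSS drop_cat szK.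
  have szS : size (fib_word n.+3) = (N + size (fib_word n) + N)%N.
    by rewrite -size_singular singular_SSS !size_cat !size_singular -/N addnA.
  have -> : (if (i < N)%N
      then drop i (singular n.+1) ++ singular n ++ singular n.+1
      else drop (i - N) (singular n ++ singular n.+1))
    = (drop i (singular n.+1) ++ singular n) ++ singular n.+1.
    case: ltnP => [_|le_Ni]; first by rewrite catA.
    have -> : i = N by apply/eqP; rewrite eqn_leq le_iN.
    by rewrite subnn drop0 drop_oversize ?szK.
  rewrite take_cat size_cat size_drop szK size_singular szS.
  case: ltnP => [|_]; first by lia.
  by rewrite -catA; congr (_ ++ (_ ++ take _ _)); lia.
have [n' En'] := index j hj; move: Ej infK max; rewrite {}En' K_singular.
move=> /singular_inj <- infK max.
have [|y [Ew lty /prefixP [z Ez]]] := palindrome_with_kernel _ hF n w pal occ infK.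
  move=> l lt_nl; apply/negP=> infl.
  by have := max (l%:Z - 1); rewrite K_singular => /(_ _ infl); lia.
exists (N - size y)%N; split=> [|i [hi Ei]].
  split; first by lia.
  rewrite leftE rightE Ew; have -> : (N - (N - size y) = size y)%N by lia.
  congr (_ ++ (_ ++ _)); last by rewrite Ez take_size_cat.
  by rewrite -rev_singular Ez rev_cat drop_size_cat // size_rev -szK Ez size_cat addKn.
have := congr1 size Ei; rewrite Ew leftE rightE !size_cat size_rev size_drop.
rewrite size_takel szK ?leq_subr //; lia.
Qed.
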